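(* Let $0\le b\le1$, $M>0$ and $0\le\alpha<1$, and let $r_0=r_0(\alpha)$ be the real root in $(0,1)$ of the equation \[M(1-\alpha+\alpha r)=\big((1+M)(1-\alpha)-(2-\alpha)(2b-M)r\big)(1-r)^2.\] Let $\mathcal{F}$ be the class of functions $f\in\mathcal{A}_b$, $f(z)=z+\sum_{n\ge2}a_nz^n$, with $|a_n|\le M$ for all $n\ge3$. Then: (i) every $f\in\mathcal{F}$ satisfies $\left|\frac{zf'(z)}{f(z)}-1\right|\le1-\alpha$ for $|z|\le r_0$; (ii) $r_0(\alpha)$ is the radius of starlikeness of order $\alpha$ of $\mathcal{F}$; (iii) $r_0(1/2)$ is the radius of parabolic starlikeness of $\mathcal{F}$. All results are sharp: the function $f_0(z)=z-2bz^2-\frac{Mz^3}{1-z}=z-2bz^2-M\sum_{n\ge3}z^n$ belongs to $\mathcal{F}$ and satisfies $\left|\frac{zf_0'(z)}{f_0(z)}-1\right|=1-\alpha$ and $\operatorname{Re}\frac{zf_0'(z)}{f_0(z)}=\alpha$ at $z=r_0$.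
   Context: $\mathbb{D}=\{z\in\mathbb{C}:|z|<1\}$. For $0\le b\le1$, $\mathcal{A}_b$ is the class of analytic functions $f$ on $\mathbb{D}$ of the form $f(z)=z+a_2z^2+a_3z^3+\cdots$ with $|a_2|=2b$. For a class $\mathcal{F}$ of analytic functions on $\mathbb{D}$ normalized by $f(0)=0$, $f'(0)=1$, and $0\le\alpha<1$, the radius of starlikeness of order $\alpha$ of $\mathcal{F}$ is the supremum of $r\in(0,1]$ such that every $f\in\mathcal{F}$ satisfies $f(z)\ne0$ for $0<|z|<r$ and $\operatorname{Re}\big(zf'(z)/f(z)\big)>\alpha$ for $|z|<r$ (the quotient being $1$ at $z=0$). The radius of parabolic starlikeness of $\mathcal{F}$ is the supremum of $r\in(0,1]$ such that every $f\in\mathcal{F}$ satisfies $\operatorname{Re}\big(zf'(z)/f(z)\big)>\left|zf'(z)/f(z)-1\right|$ for $|z|<r$. *)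

(* Defs.v *)
From HB Require Import structures.
From mathcomp Require Import all_boot all_order all_algebra.
From mathcomp Require Import all_classical all_reals all_analysis.
From mathcomp Require Import complex.
Set Implicit Arguments. Unset Strict Implicit. Unset Printing Implicit Defensive.
Import Order.TTheory GRing.Theory Num.Theory.
Import numFieldNormedType.Exports.
Local Open Scope ring_scope.
Local Open Scope complex_scope.

Section Defs.
Variable R : realType.

Definition fval (a : nat -> R[i]) (z : R[i]) : R[i] :=
  limn (series (fun n => (a n * z ^+ n : R[i]^o))).

Definition fder (a : nat -> R[i]) (z : R[i]) : R[i] :=
  fval (fun n => (n.+1)%:R * a n.+1) z.

Definition qf (a : nat -> R[i]) (z : R[i]) : R[i] :=
  if z == 0 then 1 else z * fder a z / fval a z.

(* The class F: f = z + a_2 z^2 + ... with |a_2| = 2b (f in A_b) and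
   |a_n| <= M for n >= 3.  Functions are identified with their Taylor
   coefficient sequences (the series converge on the unit disc since the
   coefficients are bounded). *)
Definition classF (b M : R) (a : nat -> R[i]) : Prop :=
  [/\ a 0%N = 0, a 1%N = 1, `|a 2%N| = (2 * b)%:C
    & forall n : nat, (3 <= n)%N -> `|a n| <= M%:C].

Definition starlike_order_on (F : (nat -> R[i]) -> Prop) (alpha r : R) : Prop :=
  forall a, F a ->
    (forall z : R[i], 0 < `|z| < r%:C -> fval a z != 0) /\
    (forall z : R[i], `|z| < r%:C -> alpha < complex.Re (qf a z)).

Definition radius_starlike (F : (nat -> R[i]) -> Prop) (alpha : R) : R :=
  sup [set r : R | 0 < r <= 1 /\ starlike_order_on F alpha r].

Definition parabolic_on (F : (nat -> R[i]) -> Prop) (r : R) : Prop :=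
  forall a, F a -> forall z : R[i], `|z| < r%:C ->
    `|qf a z - 1| < (complex.Re (qf a z))%:C.

Definition radius_parabolic (F : (nat -> R[i]) -> Prop) : R :=
  sup [set r : R | 0 < r <= 1 /\ parabolic_on F r].

Definition r0_equation (b M alpha r : R) : Prop :=
  M * (1 - alpha + alpha * r)
  = ((1 + M) * (1 - alpha) - (2 - alpha) * (2 * b - M) * r) * (1 - r) ^+ 2.

Definition is_r0 (b M alpha r : R) : Prop :=
  [/\ 0 < r < 1, r0_equation b M alpha r
    & forall s : R, 0 < s < 1 -> r0_equation b M alpha s -> s = r].

Definition f0coef (b M : R) (n : nat) : R[i] :=
  if n == 1%N then 1
  else if n == 2%N then - (2 * b)%:C
  else if (3 <= n)%N then - M%:C
  else 0.

End Defs.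

(* Main.v *)
Require Import Defs.
From HB Require Import structures.
From mathcomp Require Import all_boot all_order all_algebra.
From mathcomp Require Import all_classical all_reals all_analysis.
From mathcomp Require Import complex.
From mathcomp Require Import ring lra.
Set Implicit Arguments. Unset Strict Implicit. Unset Printing Implicit Defensive.
Import Order.TTheory GRing.Theory Num.Theory.
Import numFieldNormedType.Exports.
Local Open Scope classical_set_scope.
Local Open Scope ring_scope.
Local Open Scope complex_scope.

(* With g(z) = f(z)/z one has zf'/f - 1 = h/g, where g - 1 = sum_(n >= 2) a_n z^(n-1)
   and h = sum_(n >= 2) (n-1) a_n z^(n-1).  For |z| = r the coefficient bounds give
   |g - 1| <= S(r) and |h| <= T(r), with S and T the same sums for the majorant
   2b, M, M, ...; both are increasing in r, and the equation defining r0 says exactly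
   T(r0) = (1 - alpha)(1 - S(r0)).  All estimates are equalities for f0 at z = r, so
   there zf0'/f0 = alpha.  For alpha = 1/2, the disc |w - 1| < 1/2 lies in the parabolic
   region |w - 1| < Re w, and w = 1/2 is on the boundary of both. *)

(** * Real power series of the majorant *)

Lemma cvgn_ext (T : topologicalType) (f g : nat -> T) (l : T) :
  g @ \oo --> l -> f =1 g -> f @ \oo --> l.
Proof. by move=> gl /funext ->. Qed.

Lemma cvg_series_monomial (K : numFieldType) (x : K) (k : nat) :
  series (fun n => (n == k)%:R * x ^+ n : K^o) @ \oo --> (x ^+ k : K^o).
Proof.
apply: cvg_near_cst; exists k.+1 => //= n /= lekn.
rewrite /series /= (bigD1_seq k) ?mem_index_iota ?iota_uniq //=.
rewrite eqxx mul1r big1 ?addr0 // => i /negPf ->.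
by rewrite mul0r.
Qed.

Lemma series_arith_geometric (R : realType) (r : R) (n : nat) :
  series (fun n => n%:R * r ^+ n) n * (1 - r) ^+ 2 =
  r - n%:R * r ^+ n * (1 - r) - r ^+ n.+1.
Proof.
elim: n => [|n IHn]; first by rewrite /series /= big_geq //; ring.
rewrite seriesSr mulrDl IHn -natr1 !exprS; ring.
Qed.

Lemma cvg_series_arith_geometric (R : realType) (r : R) : 0 <= r < 1 ->
  series (fun n => n%:R * r ^+ n) @ \oo --> r / (1 - r) ^+ 2.
Proof.
case/andP=> r0 r1; have q0 : 0 < 1 - r by rewrite subr_gt0.
have q20 : 0 < (1 - r) ^+ 2 by rewrite exprn_gt0.
set t := fun n => _.
have t0 n : 0 <= t n by rewrite mulr_ge0 ?ler0n ?exprn_ge0.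
(* The partial sums increase and the closed form bounds them. Convergence then gives [t n] -> 0,
   which is what the closed form needs to pass to the limit. *)
have cvt : cvgn (series t).
  apply: nondecreasing_is_cvgn; first exact: nondecreasing_series.
  exists (r / (1 - r) ^+ 2) => _ [n _ <-].
  rewrite ler_pdivlMr // series_arith_geometric -addrA -opprD gerBl.
  by rewrite addr_ge0 ?mulr_ge0 ?ler0n ?exprn_ge0 // ltW.
have tE : series t = (fun n => (r - t n * (1 - r) - r ^+ n.+1) / (1 - r) ^+ 2).
  by apply/funext => n; rewrite /t -series_arith_geometric mulfK // gt_eqF.
have ct := cvg_series_cvg_0 cvt.
have ce : (fun n => r ^+ n.+1) @ \oo --> (0 : R).
  by rewrite (cvg_shiftS (fun n => r ^+ n)); apply: cvg_expr; rewrite ger0_norm.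
rewrite tE.
have -> : r / (1 - r) ^+ 2 = (r - 0 * (1 - r) - 0) / (1 - r) ^+ 2.
  by rewrite mul0r !subr0.
apply: cvgMr_tmp.
by apply: cvgB ce; apply: cvgB; [exact: cvg_cst | exact: cvgMr_tmp].
Qed.

(* Index shift: [tail_coef b M n] bounds the modulus of [a n.+1], for [n >= 1]. *)
Definition tail_coef (R : realType) (b M : R) (n : nat) : R :=
  if n is k.+1 then if k is _.+1 then M else 2 * b else 0.

(** This is S(r) = 2b r + M (r^2 + r^3 + ...), written with (1 - r)^-1 so that every factor is
    visibly nonnegative and increasing on [0, 1). *)
Definition tail_sum (R : realType) (b M r : R) : R :=
  2 * b * r + M * r * ((1 - r)^-1 - 1).

(** This is T(r) = 2b r + M (2 r^2 + 3 r^3 + ...), in the same form as S. *)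
Definition weighted_tail_sum (R : realType) (b M r : R) : R :=
  2 * b * r + M * r * ((1 - r)^-1 ^+ 2 - 1).

Lemma cvg_series_tail (R : realType) (b M r : R) : 0 <= r < 1 ->
  series (fun n => tail_coef b M n * r ^+ n) @ \oo --> tail_sum b M r.
Proof.
case/andP=> r0 r1; have q0 : 1 - r != 0 by rewrite subr_eq0 eq_sym lt_eqF.
have cg : series (geometric M r) @ \oo --> M / (1 - r).
  by apply: cvg_geometric_series; rewrite ger0_norm.
have c0 := @cvg_series_monomial R r 0.
have c1 := @cvg_series_monomial R r 1.
have -> : tail_sum b M r = M / (1 - r) + (2 * b - M) * r ^+ 1 - M * r ^+ 0.
  by rewrite /tail_sum; field.
(* The geometric series with all coefficients M is corrected at index 1, to 2b, and at index 0, to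
   0. *)
apply: (cvgn_ext (cvgB (cvgD cg (cvgMl_tmp (a := 2 * b - M) c1)) (cvgMl_tmp (a := M) c0))) => n /=.
rewrite !fctE /series /= !mulr_sumr -big_split -sumrB /=.
apply: eq_bigr => -[|[|i]] _ //=; rewrite ?expr0 /=; ring.
Qed.

Lemma cvg_series_weighted_tail (R : realType) (b M r : R) : 0 <= r < 1 ->
  series (fun n => n%:R * tail_coef b M n * r ^+ n) @ \oo -->
  weighted_tail_sum b M r.
Proof.
move=> r01; case/andP: (r01) => r0 r1.
have q0 : 1 - r != 0 by rewrite subr_eq0 eq_sym lt_eqF.
have cg := @cvg_series_arith_geometric R r r01.
have c1 := @cvg_series_monomial R r 1.
have -> : weighted_tail_sum b M r = M * (r / (1 - r) ^+ 2) + (2 * b - M) * r ^+ 1.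
  by rewrite /weighted_tail_sum; field.
apply: (cvgn_ext (cvgD (cvgMl_tmp (a := M) cg) (cvgMl_tmp (a := 2 * b - M) c1))) => n /=.
rewrite !fctE /series /= !mulr_sumr -big_split /=.
apply: eq_bigr => -[|[|i]] _ //=; ring.
Qed.

(** * Complex series dominated by real series *)

Lemma normC_real (R : rcfType) (x : R) : `|x%:C| = `|x|%:C.
Proof. by rewrite normc_def /= expr0n /= addr0 sqrtr_sqr. Qed.

Lemma cvg_real_complex (R : realType) (u : nat -> R) (l : R) :
  u @ \oo --> l -> (fun n => (u n)%:C : R[i]^o) @ \oo --> (l%:C : R[i]^o).
Proof.
move=> /cvgrPdist_lt ul; apply/cvgrPdist_lt => e e0.
have /complex_realP[d de] : e \is Num.real by rewrite gtr0_real.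
rewrite de ltcR in e0; near=> n.
rewrite de -rmorphB normC_real ltcR; near: n; exact: ul.
Unshelve. all: by end_near. Qed.

Lemma series_real_complex (R : realType) (u : nat -> R) (n : nat) :
  series (fun n => (u n)%:C : R[i]^o) n = (series u n)%:C.
Proof. by rewrite /series /= rmorph_sum. Qed.

(* The library has no completeness for [R[i]], hence the real and imaginary parts. *)
Lemma dominated_series_cvg (R : realType) (u : nat -> R[i]) (v : nat -> R) (V : R) :
  (forall n, `|u n| <= (v n)%:C) -> series v @ \oo --> V ->
  exists2 L : R[i], series (u : nat -> R[i]^o) @ \oo --> (L : R[i]^o) & `|L| <= V%:C.
Proof.
move=> uv vV.
have v0 n : 0 <= v n by rewrite -lecR; exact: le_trans (normr_ge0 _) (uv n).
have cvv : cvgn (series v) by apply/cvg_ex; exists V.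
have cvgdom (w : nat -> R) : (forall n, `|w n| <= v n) -> cvgn (series w).
  move=> wv; apply: normed_cvg; apply: series_le_cvg cvv => // n; apply: normr_ge0.
have cRe : cvgn (series (fun n => complex.Re (u n))).
  by apply: cvgdom => n; rewrite -lecR; exact: le_trans (normc_ge_Re _) (uv n).
have cIm : cvgn (series (fun n => complex.Im (u n))).
  apply: cvgdom => n; rewrite -lecR; apply: le_trans (uv n).
  by rewrite normc_def lecR -sqrtr_sqr ler_wsqrtr // lerDr sqr_ge0.
pose L := (limn (series (fun n => complex.Re (u n))))%:C +
  'i * (limn (series (fun n => complex.Im (u n))))%:C.
have uL : series (u : nat -> R[i]^o) @ \oo --> (L : R[i]^o).
  apply: (cvgn_ext (cvgD (cvg_real_complex cRe)
    (cvgMl_tmp (a := ('i : R[i]^o)) (cvg_real_complex cIm)))) => n /=.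
  rewrite !fctE -!series_real_complex /series /= mulr_sumr -big_split /=.
  by apply: eq_bigr => i _; rewrite -complexE.
(* One partial sum s_N within e of L suffices: |L| <= |L - s_N| + |s_N| <= e + V, as the partial
   sums of [v] increase to V. *)
exists L => //; apply/ler_addgt0Pr => e e0.
have [N _ /(_ N (leqnn _)) /= LN] := (cvgrPdist_lt _ _).1 uL e e0.
rewrite -[L](subrK (series (u : nat -> R[i]^o) N)) addrC.
rewrite (le_trans (ler_normD _ _)) // lerD ?(ltW LN) //.
rewrite /series /= (le_trans (ler_norm_sum _ _ _)) //.
apply: (@le_trans _ _ (series v N)%:C).
  by rewrite /series /= rmorph_sum ler_sum.
rewrite lecR -(cvg_lim _ vV) //; apply: nondecreasing_cvgn_le => //.
exact: nondecreasing_series.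
Qed.

(** * The quotient z f'(z)/f(z) through g(z) = f(z)/z *)

Lemma fval_eq (R : realType) (a : nat -> R[i]) (z L : R[i]) :
  series (fun n => a n * z ^+ n : R[i]^o) @ \oo --> (L : R[i]^o) -> fval a z = L.
Proof. by move=> aL; apply: cvg_lim aL; exact: norm_hausdorff. Qed.

(** Here G = g(z) and H = z g'(z), so f = z g and f' = g + z g'; on coefficients this is n + 1 = 1 +
    n. *)
Lemma fval_fder_split (R : realType) (a : nat -> R[i]) (z G H : R[i]) :
  a 0%N = 0 ->
  series (fun n => a n.+1 * z ^+ n : R[i]^o) @ \oo --> (G : R[i]^o) ->
  series (fun n => n%:R * a n.+1 * z ^+ n : R[i]^o) @ \oo --> (H : R[i]^o) ->
  fval a z = z * G /\ fder a z = G + H.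
Proof.
move=> a0 aG aH; split; apply: fval_eq.
  rewrite -cvg_shiftS; apply: (cvgn_ext (cvgMl_tmp (a := z : R[i]^o) aG)) => n /=.
  rewrite /series /= big_nat_recl // a0 mul0r add0r mulr_sumr.
  by apply: eq_bigr => i _; rewrite exprS mulrCA.
apply: (cvgn_ext (cvgD aG aH)) => n.
rewrite !fctE /series /= -big_split /=.
by apply: eq_bigr => i _; rewrite -natr1; ring.
Qed.

Lemma qf_subr1 (R : realType) (a : nat -> R[i]) (z G H : R[i]) :
  fval a z = z * G -> fder a z = G + H -> z != 0 -> G != 0 ->
  qf a z - 1 = H / G.
Proof.
by move=> fG fH z0 G0; rewrite /qf (negPf z0) fG fH; field; rewrite G0 z0.
Qed.

Lemma classF_estimate (R : realType) (b M r : R) (a : nat -> R[i]) (z : R[i]) :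
  classF b M a -> `|z| = r%:C -> 0 <= r < 1 ->
  exists G H, [/\ fval a z = z * G, fder a z = G + H,
    `|G - 1| <= (tail_sum b M r)%:C & `|H| <= (weighted_tail_sum b M r)%:C].
Proof.
case=> a0 a1 a2 aM zr r01.
(* Subtracting 1 at index 0 removes the constant term of g, so that the sum below is G - 1 and the
   majorant may start with 0. *)
have le_tail n : `|a n.+1 - (n == 0%N)%:R| <= (tail_coef b M n)%:C.
  case: n => [|[|n]] /=; first by rewrite a1 subrr normr0.
    by rewrite subr0 a2.
  by rewrite subr0 aM.
have [|G cG nG] := @dominated_series_cvg R
    (fun n => (a n.+1 - (n == 0%N)%:R) * z ^+ n) _ _ _ (@cvg_series_tail R b M r r01).
  move=> n; rewrite normrM normrX zr rmorphM rmorphXn /=.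
  by rewrite ler_wpM2r // exprn_ge0 // -zr.
have [|H cH nH] := @dominated_series_cvg R
    (fun n => n%:R * a n.+1 * z ^+ n) _ _ _ (@cvg_series_weighted_tail R b M r r01).
  move=> n; rewrite !normrM normrX zr !rmorphM rmorphXn /= rmorph_nat normr_nat.
  rewrite ler_wpM2r ?exprn_ge0 // -?zr //.
  have := le_tail n; case: n => [|n]; first by rewrite !mul0r.
  by rewrite subr0 => le_n; rewrite ler_wpM2l.
have cG1 : series (fun n => a n.+1 * z ^+ n : R[i]^o) @ \oo --> (G + 1 : R[i]^o).
  rewrite -(expr0 z); apply: (cvgn_ext (cvgD cG (@cvg_series_monomial R[i] z 0))) => n.
  rewrite !fctE /series /= -big_split /=.
  by apply: eq_bigr => i _; rewrite -mulrDl subrK.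
have [fG fH] := fval_fder_split a0 cG1 cH.
by exists (G + 1), H; split; rewrite ?addrK.
Qed.

(** * The coefficients and values of the extremal function *)

Lemma f0coef_tail (R : realType) (b M : R) (n : nat) :
  f0coef b M n.+1 = (n == 0%N)%:R - (tail_coef b M n)%:C.
Proof. by case: n => [|[|n]]; rewrite /f0coef /= ?subr0 ?sub0r. Qed.

Lemma f0coef_classF (R : realType) (b M : R) : 0 <= b -> 0 <= M ->
  classF b M (f0coef b M).
Proof.
move=> b0 M0; split=> //.
  by rewrite /f0coef /= normrN normC_real ger0_norm // mulr_ge0.
by case=> [|[|[|n]]] // _; rewrite /f0coef /= normrN normC_real ger0_norm.
Qed.

(** On [0, 1) all terms of g - 1 and of h have the same sign for f0, so G = 1 - S(r) and H = -T(r):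
    both bounds of [classF_estimate] are attained at once. *)
Lemma f0coef_series (R : realType) (b M r : R) : 0 <= r < 1 ->
  fval (f0coef b M) r%:C = r%:C * (1 - (tail_sum b M r)%:C) /\
  fder (f0coef b M) r%:C =
    (1 - (tail_sum b M r)%:C) + - (weighted_tail_sum b M r)%:C.
Proof.
move=> r01; apply: fval_fder_split => //.
  rewrite -[X in X - _](expr0 (r%:C : R[i])).
  apply: (cvgn_ext (cvgB (@cvg_series_monomial R[i] r%:C 0)
    (cvg_real_complex (@cvg_series_tail R b M r r01)))) => n.
  rewrite !fctE -series_real_complex /series /= -sumrB.
  by apply: eq_bigr => i _; rewrite f0coef_tail mulrBl rmorphM rmorphXn.
apply: (cvgn_ext (cvgN (cvg_real_complex
  (@cvg_series_weighted_tail R b M r r01)))) => n.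
rewrite !fctE -series_real_complex /series /= -sumrN.
apply: eq_bigr => i _; rewrite f0coef_tail !rmorphM rmorphXn rmorph_nat /=.
by case: i => [|i] /=; ring.
Qed.

(** * Monotonicity of S and T, and the bound on the disc *)

Lemma tail_sum_le (R : realType) (b M r s : R) : 0 <= b -> 0 < M ->
  0 <= r -> r <= s -> s < 1 -> tail_sum b M r <= tail_sum b M s.
Proof.
move=> b0 M0 r0 rs s1.
have q : (1 - r)^-1 <= (1 - s)^-1.
  by rewrite lef_pV2 ?posrE ?subr_gt0 ?(le_lt_trans rs) // lerD2l lerN2.
have q1 : 1 <= (1 - r)^-1.
  by rewrite invf_ge1 ?subr_gt0 ?(le_lt_trans rs) // gerBl.
apply: lerD; first by rewrite ler_wpM2l ?mulr_ge0.
rewrite -!mulrA ler_pM2l //; apply: ler_pM => //; first by rewrite subr_ge0.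
by rewrite lerD2r.
Qed.

(** Strictness comes from the term with M > 0, hence holds even for b = 0. It is what makes the
    final estimate strict on the open disc |z| < r0. *)
Lemma weighted_tail_sum_lt (R : realType) (b M r s : R) : 0 <= b -> 0 < M ->
  0 <= r -> r < s -> s < 1 -> weighted_tail_sum b M r < weighted_tail_sum b M s.
Proof.
move=> b0 M0 r0 rs s1.
have q : (1 - r)^-1 < (1 - s)^-1.
  by rewrite ltf_pV2 ?posrE ?subr_gt0 ?(lt_trans rs) // ltrD2l ltrN2.
have q1 : 1 <= (1 - r)^-1.
  by rewrite invf_ge1 ?subr_gt0 ?(lt_trans rs) // gerBl.
apply: ler_ltD; first by rewrite ler_wpM2l ?mulr_ge0 // ltW.
rewrite -!mulrA ltr_pM2l //; apply: ltr_pM => //.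
  by rewrite subr_ge0 exprn_ege1.
by rewrite ltrD2r ltrXn2r // (le_trans ler01).
Qed.

Lemma weighted_tail_sum_gt0 (R : realType) (b M r : R) : 0 <= b -> 0 < M ->
  0 < r -> r < 1 -> 0 < weighted_tail_sum b M r.
Proof.
move=> b0 M0 r0 r1; have := weighted_tail_sum_lt b0 M0 (lexx 0) r0 r1.
by rewrite {1}/weighted_tail_sum !mulr0 mul0r addr0.
Qed.

Lemma r0_equation_tail (R : realType) (b M alpha r : R) : r < 1 ->
  r0_equation b M alpha r ->
  weighted_tail_sum b M r = (1 - alpha) * (1 - tail_sum b M r).
Proof.
move=> r1; have q0 : 1 - r != 0 by rewrite subr_eq0 eq_sym lt_eqF.
rewrite /r0_equation /weighted_tail_sum /tail_sum => E.
apply: (mulIf (expf_neq0 2 q0)); apply/eqP; rewrite -subr_eq0; apply/eqP.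
(* Multiplied by (1 - r)^2, the difference of the two sides is the difference of the two sides of
   [r0_equation]. *)
transitivity (M * (1 - alpha + alpha * r) -
  ((1 + M) * (1 - alpha) - (2 - alpha) * (2 * b - M) * r) * (1 - r) ^+ 2).
  by field.
by rewrite E subrr.
Qed.

(** With r = |z|, the chain is |H| <= T(r) <= T(r0) = (1 - alpha)(1 - S(r0)) <= (1 - alpha)|G|, and
    its second inequality is strict when r < r0. *)
Lemma classF_disk_bound (R : realType) (b M alpha r0 : R) (a : nat -> R[i])
    (z : R[i]) :
  0 <= b -> 0 < M -> alpha < 1 -> 0 < r0 < 1 -> r0_equation b M alpha r0 ->
  classF b M a -> `|z| <= r0%:C ->
  [/\ z != 0 -> fval a z != 0, `|qf a z - 1| <= (1 - alpha)%:C
    & `|z| < r0%:C -> `|qf a z - 1| < (1 - alpha)%:C].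
Proof.
move=> b0 M0 al1 /andP[r0_gt0 r0_lt1] E Fa zr0.
have c0 : 0 < 1 - alpha by rewrite subr_gt0.
have [->|z0] := eqVneq z 0.
  by rewrite /qf eqxx subrr normr0 lecR !ltcR; split; rewrite ?ltW.
have /complex_realP[r zr] : `|z| \is Num.real by exact: normr_real.
have r_ge0 : 0 <= r by rewrite -ler0c -zr normr_ge0.
rewrite zr lecR in zr0; rewrite zr ltcR.
have r01 : 0 <= r < 1 by rewrite r_ge0 (le_lt_trans zr0).
have W0 := weighted_tail_sum_gt0 b0 M0 r0_gt0 r0_lt1.
have Er := r0_equation_tail r0_lt1 E.
(* The equation forces S(r0) < 1, since T(r0) and 1 - alpha are positive; this keeps G away from
   0. *)
have S1 : 0 < 1 - tail_sum b M r0 by move: W0; rewrite Er pmulr_rgt0.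
have Sr := tail_sum_le b0 M0 r_ge0 zr0 r0_lt1.
have [G [H [fG fH nG nH]]] := classF_estimate Fa zr r01.
have nG0 : (1 - tail_sum b M r0)%:C <= `|G|.
  rewrite rmorphB rmorph1 lerBlDr.
  have : 1 <= `|G| + `|G - 1|.
    by rewrite -[leLHS](@normr1 R[i]) -{1}(subKr G 1) ler_normB.
  by move/le_trans; apply; rewrite lerD2l (le_trans nG) // lecR.
have G0 : G != 0 by rewrite -normr_gt0 (lt_le_trans _ nG0) // ltcR.
have G_gt0 : 0 < `|G| by rewrite normr_gt0.
rewrite (qf_subr1 fG fH z0 G0) normrM normfV.
rewrite ler_pdivrMr // ltr_pdivrMr //.
have bound : (weighted_tail_sum b M r0)%:C <= (1 - alpha)%:C * `|G|.
  by rewrite Er rmorphM ler_pM2l // ltcR.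
split=> [_||rr0]; first by rewrite fG mulf_neq0.
  apply: le_trans nH (le_trans _ bound); rewrite lecR.
  move: zr0; rewrite le_eqVlt => /predU1P[-> //|rr0].
  exact/ltW/weighted_tail_sum_lt.
apply: le_lt_trans nH (lt_le_trans _ bound); rewrite ltcR.
exact: weighted_tail_sum_lt.
Qed.

(** For f0 at r0 the quotient H/G is -T(r0)/(1 - S(r0)) = -(1 - alpha). *)
Lemma f0coef_extremal (R : realType) (b M alpha r0 : R) :
  0 <= b -> 0 < M -> alpha < 1 -> 0 < r0 < 1 -> r0_equation b M alpha r0 ->
  qf (f0coef b M) r0%:C = alpha%:C.
Proof.
move=> b0 M0 al1 /andP[r0_gt0 r0_lt1] E.
have Er := r0_equation_tail r0_lt1 E.
have W0 := weighted_tail_sum_gt0 b0 M0 r0_gt0 r0_lt1.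
have S1 : 1 - tail_sum b M r0 != 0.
  by apply: contraTneq W0 => S1; rewrite Er S1 mulr0 ltxx.
have [|fG fH] := @f0coef_series R b M r0; first by rewrite ltW.
have G0 : 1 - (tail_sum b M r0)%:C != 0 :> R[i].
  by rewrite -(rmorphB (real_complex R) 1) fmorph_eq0.
have z0 : r0%:C != 0 :> R[i] by rewrite fmorph_eq0 gt_eqF.
apply: (addIr (-1)); rewrite (qf_subr1 fG fH z0 G0).
apply: (mulIf G0); rewrite divfK // Er !rmorphM !rmorphB /=; ring.
Qed.

(** * The radii as attained suprema *)

Lemma sup_max (R : realType) (A : set R) (x : R) :
  A x -> ubound A x -> sup A = x.
Proof.
move=> Ax ubx; apply/eqP; rewrite eq_le ge_sup /=; last 2 first.
- by exists x.
- by [].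
by apply: ub_le_sup => //; exists x.
Qed.

Lemma Re_gt_of_dist1 (R : realType) (q : R[i]) (c : R) :
  `|q - 1| < (1 - c)%:C -> c < complex.Re q.
Proof.
move/(le_lt_trans (normc_ge_Re _)); rewrite ltcR.
case: q => x y /=; rewrite ltr_norml => /andP[h _]; lra.
Qed.

Local Close Scope classical_set_scope.

Theorem theorem2p5 (R : realType) (b M alpha r0 : R) :
  0 <= b <= 1 -> 0 < M -> 0 <= alpha < 1 ->
  is_r0 b M alpha r0 ->
  (* (i) *)
  (forall a, classF b M a -> forall z : R[i], `|z| <= r0%:C ->
     `|qf a z - 1| <= (1 - alpha)%:C) /\
  (* (ii) *)
  radius_starlike (classF b M) alpha = r0 /\
  (* (iii) *)
  (forall r1 : R, is_r0 b M (1 / 2) r1 -> radius_parabolic (classF b M) = r1) /\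
  (* sharpness *)
  [/\ classF b M (f0coef b M),
      `|qf (f0coef b M) r0%:C - 1| = (1 - alpha)%:C
    & complex.Re (qf (f0coef b M) r0%:C) = alpha].
Proof.
case/andP=> b0 _ M0 /andP[al0 al1] [r01 E _].
have FE := f0coef_classF b0 (ltW M0).
have ext := f0coef_extremal b0 M0 al1 r01 E.
split; first by move=> a Fa z /(classF_disk_bound b0 M0 al1 r01 E Fa)[].
split.
  case/andP: (r01) => r0_gt0 r0_lt1; apply: sup_max.
    (* The conditions concern the open disc |z| < r, so r0 itself is admissible. *)
    split; first by rewrite r0_gt0 ltW.
    move=> a Fa; split=> z.
      case/andP=> z0 /ltW zr.
      have [nz _ _] := classF_disk_bound b0 M0 al1 r01 E Fa zr.
      by apply: nz; rewrite -normr_gt0.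
    move=> zr; have [_ _] := classF_disk_bound b0 M0 al1 r01 E Fa (ltW zr).
    by move=> /(_ zr)/Re_gt_of_dist1.
  (* If r > r0, the point r0 lies in the disc, and there f0 gives real part exactly alpha, against
     the strict inequality. *)
  move=> r [_ /(_ _ FE)[_ star]]; rewrite leNgt; apply/negP => r0r.
  have := star r0%:C; rewrite ext normC_real gtr0_norm // ltcR => /(_ r0r) /=.
  by rewrite ltxx.
split=> [r1 [r1_01 E1 _]|]; last first.
  split; rewrite ?ext //= -(rmorphB (real_complex R) alpha 1) normC_real.
  by rewrite distrC ger0_norm // subr_ge0 ltW.
have half1 : 1 / 2 < 1 :> R by lra.
have halfE : 1 - 1 / 2 = 1 / 2 :> R by lra.
case/andP: (r1_01) => r1_gt0 r1_lt1; apply: sup_max.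
  split; first by rewrite r1_gt0 ltW.
  move=> a Fa z zr.
  have [_ _ /(_ zr) q] := classF_disk_bound b0 M0 half1 r1_01 E1 Fa (ltW zr).
  (* For alpha = 1/2 the same disc yields |q - 1| < 1/2 < Re q. *)
  have := Re_gt_of_dist1 q; rewrite halfE in q.
  by rewrite -ltcR; apply: lt_trans.
(* At r1 the quotient of f0 is 1/2, where |q - 1| = Re q = 1/2. *)
move=> r [_ /(_ _ FE) par]; rewrite leNgt; apply/negP => r1r.
have := par r1%:C; rewrite (f0coef_extremal b0 M0 half1 r1_01 E1).
rewrite normC_real gtr0_norm // ltcR => /(_ r1r) /=.
rewrite -(rmorphB (real_complex R) (1 / 2) 1) normC_real ltcR distrC halfE.
by rewrite ger0_norm ?ltxx //; lra.
Qed.
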